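(* Consider weighted aggregating SGD with $p$ workers, weights $\theta^1,\dots,\theta^p$, learning rate $\eta$ and communication probability $\zeta$, applied to $F(x)=\frac12cx^2$ as described in the context. Given $\omega$ and $\delta$, where $$\omega=\sum_{i=1}^p(\theta^i)^2,\qquad \delta=\frac{\zeta}{(1-\zeta)\,\eta\,(2c-\eta c^2)},$$ the asymptotic variance of weighted aggregating SGD is $$\lim_{t\to\infty}\operatorname{Var}\Big(\sum_{i=1}^p\theta^i x^i_t\Big)=\eta\,\sigma_{\tilde h}^2\,\omega\left(2c-\eta c^2-\eta\,\sigma_{\tilde b}^2\,\frac{1+\delta\omega}{1+\delta}\right)^{-1}.$$
   Context: Here $x^i_t\in\mathbb{R}$ is the parameter of worker $i$ at time $t$, and the weights are normalized, $\sum_{i=1}^p\theta^i=1$. Gradient samples of $F(x)=\frac12cx^2$ have the form $g(x)=cx-\tilde b x-\tilde h$, where $\tilde b,\tilde h$ are random variables with mean zero and variances $\sigma_{\tilde b}^2,\sigma_{\tilde h}^2$; the updates are independent of each other. The $p$ workers choose to communicate with each other with probability $\zeta$ at each step: with probability $1-\zeta$ there is no communication and each worker performs the SGD update $x^i_{t+1}=x^i_t-\eta g(x^i_t)=(1-\eta c)x^i_t+\eta(\tilde b\,x^i_t+\tilde h)$; with probability $\zeta$ the workers communicate and each worker sets $x^i_{t+1}=\sum_{j=1}^p\theta^j x^j_t$.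
   Formalization: Added assumptions: square-integrable starting points, 2c−ηc²>0, and positivity of the quantity inverted in the conclusion (with η>0, 0≤ζ<1). Without stability the variance can diverge, e.g. p=1, c=1, η=3, ζ=0, σ_b=0, σ_h=1. *)

(* Defs.v *)
From mathcomp Require Import all_boot all_order all_algebra.
From mathcomp Require Import all_classical all_reals all_analysis.

Set Implicit Arguments.
Unset Strict Implicit.
Unset Printing Implicit Defensive.

Import Order.TTheory GRing.Theory Num.Theory.
Import numFieldNormedType.Exports.

Local Open Scope classical_set_scope.
Local Open Scope ring_scope.

(* Mutual independence of a family of sub-sigma-algebras F k: the product rule
   holds along every finite subfamily. *)
Definition mutually_independent (d : measure_display) (T : measurableType d)
    (R : realType) (P : probability T R) (I : eqType) (F : I -> set (set T)) :=
  forall (s : seq I) (A : I -> set T), uniq s ->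
    (forall k, k \in s -> F k (A k)) ->
    P (\big[setI/setT]_(k <- s) A k) = (\prod_(k <- s) P (A k))%E.

Definition grad_sample (R : realType) (c b h x : R) : R := c * x - b * x - h.

Definition sgd_update (R : realType) (eta c b h x : R) : R :=
  x - eta * grad_sample c b h x.

Definition weighted_avg (R : realType) (p : nat) (theta x : 'I_p -> R) : R :=
  \sum_(i < p) theta i * x i.

(* [comm t] is a single flag shared by all workers: when it is raised at step
   [t], every worker moves to the weighted average; otherwise worker [i] makes a
   gradient step with the noise pair [(b t i, h t i)]. *)
Fixpoint wasgd (R : realType) (T : Type) (p : nat) (theta : 'I_p -> R)
    (eta c : R) (x0 : 'I_p -> T -> R) (comm : nat -> T -> bool)
    (b h : nat -> 'I_p -> T -> R) (t : nat) (i : 'I_p) (w : T) : R :=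
  if t is s.+1 then
    let x := wasgd theta eta c x0 comm b h s in
    if comm s w then weighted_avg theta (fun j => x j w)
    else sgd_update eta c (b s i w) (h s i w) (x i w)
  else x0 i w.

(* The sigma-algebra of each elementary source of randomness: [None] is the
   vector of starting points, [Some (inl t)] the communication flag of step [t],
   and [Some (inr (t, i))] the pair [(b t i, h t i)] of the gradient sample of
   worker [i] at step [t]. Independence of this family leaves the dependence
   between [b t i] and [h t i], and between the starting points, arbitrary. *)
Definition source_sigma (R : realType) (d : measure_display)
    (T : measurableType d) (p : nat) (x0 : 'I_p -> T -> R)
    (comm : nat -> T -> bool) (b h : nat -> 'I_p -> T -> R)
    (k : option (nat + nat * 'I_p)) : set (set T) :=
  match k with
  | None => g_sigma_preimage x0
  | Some (inl t) => preimage_set_system setT (comm t) measurable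
  | Some (inr (t, i)) => g_sigma_preimageU (b t i) (h t i)
  end.

(* Main.v *)
Require Import Defs.
From mathcomp Require Import all_boot all_order all_algebra.
From mathcomp Require Import all_classical all_reals all_analysis.
From mathcomp Require Import measurable_realfun ring lra.


Set Implicit Arguments.
Unset Strict Implicit.
Unset Printing Implicit Defensive.

Import Order.TTheory GRing.Theory Num.Theory.
Import numFieldNormedType.Exports.

Local Open Scope classical_set_scope.
Local Open Scope ring_scope.

(* The iterates of step t are polynomials in the sources of randomness of the
   previous steps, and the expectation of a product factors over distinct
   sources, so E[x^i] and E[x^i x^j] obey a closed linear recursion. With
   A = E[(sum_i theta^i x^i)^2] and D = sum_i (theta^i)^2 E[(x^i)^2], the
   recursion for (A, D) is affine with a nonnegative 2x2 matrix N, up to an error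
   which comes from the correlation of b with h, is proportional to the means
   E[x^i], and hence tends to 0. The stability hypothesis says exactly that
   det(1 - N) > 0; as moreover N_11 < 1, N contracts a weighted l1-norm, so A
   converges to its fixed point, while E[sum_i theta^i x^i] tends to 0. *)

(** * Product rule for the integral of a weight times an independent nonnegative function *)

Section nonneg_product.
Context d (T : measurableType d) (R : realType) (P : {measure set T -> \bar R}).
Local Open Scope ereal_scope.

Import HBNNSimple.

(** Decompose [g] over its finitely many values. The weight [V] is general because the formula is
    needed both for the given weight and for the constant 1. *)
Let integral_mul_simple (V f : T -> R) (g : {nnsfun R >-> R}) :
  measurable_fun [set: T] V -> (forall w, 0 <= V w)%R -> measurable_fun [set: T] f ->
  \int[P]_w (V w * g (f w))%:E =
    \sum_(y \in range g) y%:E * \int[P]_w (V w * \1_(f @^-1` (g @^-1` [set y])) w)%:E.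
Proof.
move=> mV V0 mf.
have mfg y : measurable (f @^-1` (g @^-1` [set y])).
  by rewrite -[X in measurable X]setTI; exact: mf.
transitivity (\int[P]_w (\sum_(y \in range g)
    y%:E * (V w * \1_(f @^-1` (g @^-1` [set y])) w)%:E)).
  apply: eq_integral => w _.
  under eq_fsbigr => y _ do rewrite -EFinM mulrCA EFinM.
  rewrite -ge0_mule_fsumr; last by move=> y; exact: nnfun_muleindic_ge0.
  by rewrite fsumEFin// {1}(fimfunE g (f w)) EFinM.
(* A negative [y] is not a value of [g], so its indicator vanishes and nonnegativity holds for every
   real [y]. *)
have ge0 y w : 0 <= y%:E * (V w * \1_(f @^-1` (g @^-1` [set y])) w)%:E.
  have [[x _ <-]|ngy] := pselect (range g y).
    by apply: mule_ge0; rewrite lee_fin// mulr_ge0.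
  rewrite (_ : _ @^-1` _ = set0) ?indic0 ?mulr0 ?mule0//.
  by rewrite -subset0 => z /= gz; apply: ngy; exists (f z).
have mVI y : measurable_fun [set: T]
    (fun w => (V w * \1_(f @^-1` (g @^-1` [set y])) w)%:E).
  by apply/measurable_EFinP; apply: measurable_funM.
rewrite ge0_integral_fsum//.
- apply: eq_fsbigr => y; rewrite inE => -[x _ <-].
  by rewrite ge0_integralZl ?lee_fin// => w _; rewrite lee_fin mulr_ge0.
- by move=> y; exact: measurable_funeM.
Qed.

(** Independence is assumed on indicators of preimages under [f]; it passes to simple functions of
    [f] by linearity and to [f] by monotone convergence. *)
Lemma ge0_integral_mul_indep (V f : T -> R) :
  P setT = 1 ->
  P.-integrable setT (EFin \o V) -> (forall w, 0 <= V w)%R ->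
  measurable_fun [set: T] f -> (forall w, 0 <= f w)%R ->
  (forall B, measurable B -> \int[P]_w (V w * \1_(f @^-1` B) w)%:E =
     (\int[P]_w (V w)%:E) * P (f @^-1` B)) ->
  \int[P]_w (V w * f w)%:E = (\int[P]_w (V w)%:E) * \int[P]_w (f w)%:E.
Proof.
move=> P1 iV V0 mf f0 Vf.
have mV : measurable_fun [set: T] V by apply/measurable_EFinP; exact: measurable_int iV.
(* The approximated function is the absolute value on [R], not [f] on [T]: each approximant is then
   a simple function of [f], and since [f] is nonnegative the limit is [f] itself. *)
have mn : measurable_fun [set: R] (fun y : R => `|y|%:E).
  by apply/measurable_EFinP; exact: normr_measurable.
pose g := nnsfun_approx measurableT mn.
have simple n : \int[P]_w (V w * g n (f w))%:E =
    (\int[P]_w (V w)%:E) * \int[P]_w (g n (f w))%:E.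
  rewrite integral_mul_simple//.
  under eq_fsbigr do rewrite Vf// muleCA.
  rewrite -ge0_mule_fsumr; last first.
    move=> y; have [[x _ <-]|] := pselect (range (g n) y).
      by rewrite mule_ge0// lee_fin.
    move=> ngy; rewrite (_ : _ @^-1` _ = set0) ?measure0 ?mule0//.
    by rewrite -subset0 => z /= gz; apply: ngy; exists (f z).
  congr (_ * _).
  under [RHS]eq_integral do rewrite -[g n _]mul1r.
  rewrite (@integral_mul_simple (cst 1%R))//.
  apply: eq_fsbigr => y _; congr (_ * _).
  under eq_integral do rewrite mul1r.
  rewrite integral_indic ?setIT//.
  by rewrite -[X in measurable X]setTI; exact: mf.
have mgf n : measurable_fun [set: T] (fun w => (g n (f w))%:E).
  by apply/measurable_EFinP; apply: measurableT_comp.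
have cgf w : (g n (f w))%:E @[n --> \oo] --> (f w)%:E.
  rewrite -[in X in _ --> X](ger0_norm (f0 w)).
  exact: (@cvg_nnsfun_approx _ _ _ _ measurableT _ mn (fun x _ => normr_ge0 x) (f w) I).
have ndg w a b : (a <= b)%N -> (g a (f w) <= g b (f w))%R.
  by move=> ab; exact/lefP/nd_nnsfun_approx.
have lim1 : \int[P]_w (g n (f w))%:E @[n --> \oo] --> \int[P]_w (f w)%:E.
  have -> : \int[P]_w (f w)%:E = \int[P]_w lim ((g n (f w))%:E @[n --> \oo]).
    by apply: eq_integral => w _; apply/esym/cvg_lim.
  apply: cvg_monotone_convergence => //.
  - by move=> n w _; rewrite lee_fin.
  - by move=> w _ a b ab; rewrite lee_fin; exact: ndg.
have lim2 : \int[P]_w (V w * g n (f w))%:E @[n --> \oo] --> \int[P]_w (V w * f w)%:E.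
  have -> : \int[P]_w (V w * f w)%:E = \int[P]_w lim ((V w * g n (f w))%:E @[n --> \oo]).
    apply: eq_integral => w _; apply/esym/cvg_lim => //.
    under eq_fun do rewrite EFinM.
    by rewrite EFinM; apply: cvgeZl.
  apply: cvg_monotone_convergence => //.
  - move=> n; apply/measurable_EFinP/measurable_funM => //.
    by apply/measurable_EFinP; exact: mgf.
  - by move=> n w _; rewrite lee_fin mulr_ge0.
  - by move=> w _ a b ab; rewrite lee_fin ler_wpM2l//; exact: ndg.
rewrite -(cvg_lim _ lim2)//; under eq_fun do rewrite simple.
by apply/cvg_lim => //; apply: cvgeZl => //; exact: integrable_fin_num.
Qed.

End nonneg_product.

(** Measurability relative to an explicit set system, since one space [T] carries many sources and
    each has its own sigma-algebra. *)
Definition adapted (T : Type) (R : realType) (F : set (set T)) (f : T -> R) :=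
  forall B : set R, measurable B -> F (f @^-1` B).

(** * Expectations of products over independent sources *)

Section independent_products.
Context d (T : measurableType d) (R : realType) (P : probability T R).
Context (I : eqType) (G : I -> set (set T)).
Hypothesis Gm : forall k, G k `<=` measurable.
Hypothesis G_indep : mutually_independent P G.

Lemma adapted_measurable k (f : T -> R) :
  adapted (G k) f -> measurable_fun [set: T] f.
Proof. by move=> fk _ B mB; rewrite setTI; exact/Gm/fk. Qed.

Lemma adapted_comp (F : set (set T)) (g : R -> R) (f : T -> R) :
  measurable_fun [set: R] g -> adapted F f -> adapted F (g \o f).
Proof.
move=> mg fF B mB; rewrite comp_preimage; apply: fF.
by rewrite -[X in measurable X]setTI; exact: mg.
Qed.

Lemma prode_fin_num (s : seq I) (F : I -> \bar R) :
  (forall k, k \in s -> F k \is a fin_num) ->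
  (\prod_(k <- s) F k)%E \is a fin_num.
Proof.
move=> Fs; rewrite big_seq.
by elim/big_ind: _ => // x y xf yf; rewrite fin_numM.
Qed.

(** Events are turned into functions one source at a time. With [s] empty this is the definition of
    independence; the list [s'] of events is kept general so that the induction hypothesis can
    absorb one more event, a preimage under [f k]. *)
Lemma integral_prod_indep (s s' : seq I) (f : I -> T -> R) (A : I -> set T) :
  uniq (s ++ s') -> (forall k, k \in s' -> G k (A k)) ->
  (forall k, k \in s -> [/\ adapted (G k) (f k),
     P.-integrable setT (EFin \o f k) & forall w, 0 <= f k w]) ->
  (\int[P]_w ((\prod_(k <- s) f k w) * \prod_(k <- s') \1_(A k) w)%:E =
   (\prod_(k <- s) \int[P]_w (f k w)%:E) * \prod_(k <- s') P (A k))%E.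
Proof.
elim: s s' A => [|k s IH] s' A /=.
  move=> us AG _; rewrite big_nil mul1e -G_indep//.
  have -> : (fun w => ((\prod_(k <- [::]) f k w) * \prod_(k <- s') \1_(A k) w)%:E) =
      (fun w => (\1_(\big[setI/setT]_(k <- s') A k) w)%:E).
    apply/funext => w; rewrite big_nil mul1r; congr _%:E.
    elim: s' {us AG} => [|j s' IHs]; first by rewrite !big_nil indicT.
    by rewrite !big_cons IHs indicI.
  rewrite integral_indic ?setIT//.
  elim: s' us AG => [|j s' IHs] /= us AG; first by rewrite big_nil.
  rewrite big_cons; apply: measurableI; first by apply/(@Gm j)/AG/mem_head.
  case/andP: us => _ us; apply: IHs => // i is'.
  by apply: AG; rewrite inE is' orbT.
rewrite mem_cat negb_or -andbA => /and3P[ks ks' us] AG fG.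
have [fk ifk fk0] := fG _ (mem_head _ _).
have {}fG j : j \in s -> [/\ adapted (G j) (f j),
     P.-integrable setT (EFin \o f j) & forall w, 0 <= f j w].
  by move=> js; apply: fG; rewrite inE js orbT.
pose V w := (\prod_(k <- s) f k w) * \prod_(k <- s') \1_(A k) w.
have VE : (\int[P]_w (V w)%:E =
   (\prod_(k <- s) \int[P]_w (f k w)%:E) * \prod_(k <- s') P (A k))%E.
  exact: IH.
have V0 w : 0 <= V w.
  apply: mulr_ge0; last exact: prodr_ge0.
  by rewrite big_seq; apply: prodr_ge0 => j /fG[].
have mV : measurable_fun [set: T] V.
  apply: measurable_funM.
    by apply: measurable_prod => j /fG[fj _ _]; exact: adapted_measurable fj.
  by apply: measurable_prod => j /AG/Gm ?; exact: measurable_indic.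
(* [V] is nonnegative, so the value [VE] of its integral, a product of finite factors, already gives
   integrability. *)
have iV : P.-integrable setT (EFin \o V).
  apply/integrableP; split; first exact/measurable_EFinP.
  under eq_integral do rewrite /= ger0_norm//.
  rewrite VE ltey_eq fin_numM//; apply: prode_fin_num => j.
    by move=> /fG[_ ij _]; exact: integrable_fin_num ij.
  by move=> /AG/Gm ?; exact: fin_num_measure.
transitivity (\int[P]_w (V w * f k w)%:E)%E.
  by apply: eq_integral => w _; rewrite big_cons /V -mulrA mulrC.
rewrite ge0_integral_mul_indep//.
- by rewrite VE big_cons -[RHS]muleA [RHS]muleC.
- exact: probability_setT.
- exact: adapted_measurable fk.
move=> B mB; rewrite VE.
(* The induction hypothesis is applied to [k :: s'], with the preimage of [B] as event at [k]; as
   [k] is not in [s'], the other events are unchanged. *)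
pose A' j := if j == k then f k @^-1` B else A j.
have A'A j : j \in s' -> A' j = A j.
  by rewrite /A'; case: eqVneq => // -> ks''; rewrite ks'' in ks'.
have A'k : A' k = f k @^-1` B by rewrite /A' eqxx.
have := IH (k :: s') A' _ _ fG.
rewrite big_cons A'k (eq_big_seq _ (fun j js => congr1 P (A'A j js))).
move=> IHk; rewrite -muleA [(_ * P _)%E]muleC -IHk.
- apply: eq_integral => w _; rewrite /V big_cons A'k.
  rewrite -mulrA [X in _ * X]mulrC; congr (_ * (_ * _))%:E.
  by apply: eq_big_seq => j js; rewrite A'A.
- by rewrite uniq_catC /= mem_cat negb_or ks' ks uniq_catC.
- move=> j; rewrite inE => /predU1P[->|js]; first by rewrite A'k; exact: fk.
  by rewrite A'A//; exact: AG.
Qed.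


(* U has mean u, and multiplying it by nonnegative functions of distinct sources
   outside K multiplies its expectation by theirs. Using this instead of
   measurability with respect to the sigma-algebra generated by K avoids the
   pi-lambda argument that grouping independent sources would require. *)
Definition free_mean (K : pred I) (U : T -> R) (u : R) :=
  forall (s : seq I) (f : I -> T -> R), uniq s ->
    (forall k, k \in s -> [/\ ~~ K k, adapted (G k) (f k),
     P.-integrable setT (EFin \o f k) & forall w, 0 <= f k w]) ->
  P.-integrable setT (fun w => (U w * \prod_(k <- s) f k w)%:E) /\
  (\int[P]_w (U w * \prod_(k <- s) f k w)%:E =
   u%:E * \prod_(k <- s) \int[P]_w (f k w)%:E)%E.

Lemma eq_free_mean (K : pred I) (U U' : T -> R) (u u' : R) :
  U =1 U' -> u = u' -> free_mean K U u -> free_mean K U' u'.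
Proof. by move=> /funext-> ->. Qed.

(** The starting point of the calculus: the product formula without events says that the constant 1
    involves no source. *)
Lemma free_mean1 : free_mean pred0 (cst 1) 1.
Proof.
move=> s f us sf.
have fE : (\int[P]_w (\prod_(k <- s) f k w)%:E =
   \prod_(k <- s) \int[P]_w (f k w)%:E)%E.
  have := @integral_prod_indep s [::] f (fun=> setT).
  rewrite cats0 => /(_ us); rewrite big_nil mule1 => <-//.
    by apply: eq_integral => w _; rewrite big_nil mulr1.
  by move=> k /sf[].
have f0 w : 0 <= \prod_(k <- s) f k w.
  by rewrite big_seq; apply: prodr_ge0 => k /sf[].
have -> : (fun w => (cst 1 w * \prod_(k <- s) f k w)%:E) =
    (fun w => (\prod_(k <- s) f k w)%:E) :> (T -> \bar R).
  by apply/funext => w; rewrite mul1r.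
split; last by rewrite mul1e.
apply/integrableP; split.
  apply/measurable_EFinP/measurable_prod => k /sf[_ fk _ _].
  exact: adapted_measurable fk.
under eq_integral do rewrite /= ger0_norm//.
rewrite fE ltey_eq prode_fin_num// => k.
by move=> /sf[_ _ fi _]; exact: integrable_fin_num fi.
Qed.

Lemma free_mean_sub (K K' : pred I) U u :
  subpred K K' -> free_mean K U u -> free_mean K' U u.
Proof.
move=> KK' KU s f us sf; apply: KU => // k /sf[nK' ? ? ?]; split=> //.
exact: contra (KK' k) nK'.
Qed.

Lemma free_mean_integral K U u : free_mean K U u ->
  P.-integrable setT (EFin \o U) /\ (\int[P]_w (U w)%:E = u%:E)%E.
Proof.
move=> /(_ [::] (fun=> cst 1) isT); rewrite big_nil mule1.
have -> : (fun w => (U w * \prod_(k <- [::] : seq I) cst 1 w)%:E) = EFin \o U.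
  by apply/funext => w; rewrite big_nil mulr1.
by apply.
Qed.

Lemma free_mean_lin K (a a' : R) U u U' u' :
  free_mean K U u -> free_mean K U' u' ->
  free_mean K (fun w => a * U w + a' * U' w) (a * u + a' * u').
Proof.
move=> KU KU' s f us sf.
have [iU EU] := KU s f us sf; have [iU' EU'] := KU' s f us sf.
have -> : (fun w => ((a * U w + a' * U' w) * \prod_(k <- s) f k w)%:E) =
    (fun w => a%:E * (U w * \prod_(k <- s) f k w)%:E +
     a'%:E * (U' w * \prod_(k <- s) f k w)%:E)%E.
  by apply/funext => w; rewrite -!EFinM -EFinD mulrDl !mulrA.
have := integrableZl measurableT a iU; have := integrableZl measurableT a' iU'.
move=> iaU' iaU; split; first exact: integrableD.
rewrite integralD// !integralZl// EU EU' !muleA -!EFinM EFinD muleDl//.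
by apply: prode_fin_num => k /sf[_ _ fi _]; exact: integrable_fin_num fi.
Qed.

Lemma free_meanZ K (a : R) U u :
  free_mean K U u -> free_mean K (fun w => a * U w) (a * u).
Proof.
move=> KU; have := free_mean_lin a 0 KU KU.
by apply: eq_free_mean => [w|]; rewrite mul0r addr0.
Qed.

Lemma free_meanD K U u U' u' : free_mean K U u -> free_mean K U' u' ->
  free_mean K (fun w => U w + U' w) (u + u').
Proof.
move=> KU KU'; have := free_mean_lin 1 1 KU KU'.
by apply: eq_free_mean => [w|]; rewrite !mul1r.
Qed.

Lemma free_mean_sum K (J : Type) (r : seq J) (U : J -> T -> R) (u : J -> R) :
  (forall j, free_mean K (U j) (u j)) ->
  free_mean K (fun w => \sum_(j <- r) U j w) (\sum_(j <- r) u j).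
Proof.
move=> KU; elim: r => [|j r IH].
  rewrite big_nil [X in free_mean _ X](_ : _ = (fun w => 0 * cst 1 w)).
    rewrite -[X in free_mean _ _ X](mul0r 1); apply: free_meanZ.
    exact: free_mean_sub free_mean1.
  by apply/funext => w; rewrite big_nil mul0r.
rewrite big_cons [X in free_mean _ X](_ : _ =
  (fun w => U j w + \sum_(j <- r) U j w)); last first.
  by apply/funext => w; rewrite big_cons.
exact: free_meanD.
Qed.

(** A nonnegative [g] can itself serve as a test function: use the property of [U] on the list
    [k :: s], with [g] at [k]. *)
Let free_mean_mul_ge0 K k U u (g : T -> R) e : free_mean K U u -> ~~ K k ->
  adapted (G k) g -> P.-integrable setT (EFin \o g) -> (forall w, 0 <= g w) ->
  (\int[P]_w (g w)%:E = e%:E)%E ->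
  free_mean (predU1 k K) (fun w => U w * g w) (u * e).
Proof.
move=> KU Kk gk ig g0 gE s f us sf.
pose f' j := if j == k then g else f j.
have f'f j : j \in s -> f' j = f j.
  by move=> /sf[]; rewrite /f' /= negb_or => /andP[/negbTE ->].
have [||] := KU (k :: s) f'.
- by rewrite /= us andbT; apply/negP => /sf[/=]; rewrite eqxx.
- move=> j; rewrite inE => /predU1P[->|js]; first by rewrite /f' eqxx; split.
  by rewrite f'f//; have [/= /norP[_ ?] ? ? ?] := sf _ js.
have f'k : f' k = g by rewrite /f' eqxx.
have -> : (fun w => (U w * \prod_(j <- (k :: s)) f' j w)%:E) =
    (fun w => (U w * g w * \prod_(k <- s) f k w)%:E).
  apply/funext => w; rewrite big_cons f'k mulrA; congr (_ * _)%:E.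
  by apply: eq_big_seq => j js; rewrite f'f.
rewrite big_cons f'k gE muleA -EFinM => iU ->; split=> //.
by congr (_ * _)%E; apply: eq_big_seq => j js; rewrite f'f.
Qed.

(** Test functions in [free_mean] are nonnegative, so [g] is split into its positive and negative
    parts, which are adapted to the same source and integrable. *)
Lemma free_mean_mul K k U u (g : T -> R) e : free_mean K U u -> ~~ K k ->
  adapted (G k) g -> P.-integrable setT (EFin \o g) ->
  (\int[P]_w (g w)%:E = e%:E)%E ->
  free_mean (predU1 k K) (fun w => U w * g w) (u * e).
Proof.
move=> KU Kk gk ig gE.
pose gp w := Num.max (g w) 0; pose gn w := Num.max (- g w) 0.
have gpn w : g w = gp w - gn w.
  rewrite /gp /gn; have [g0|g0] := leP (g w) 0.
    by rewrite max_l ?oppr_ge0// sub0r opprK.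
  by rewrite max_r ?subr0// oppr_le0 ltW.
have mg : measurable_fun [set: T] g by exact: adapted_measurable gk.
have mmax : measurable_fun [set: R] (fun x : R => Num.max x 0).
  exact: measurable_maxr.
have mmaxN : measurable_fun [set: R] (fun x : R => Num.max (- x) 0).
  by apply: measurable_maxr => //; exact: oppr_measurable.
have igp : P.-integrable setT (EFin \o gp).
  apply: le_integrable ig => //.
    by apply/measurable_EFinP; exact: (measurableT_comp mmax).
  by move=> w _; rewrite /= lee_fin /gp; have [g0|g0] := leP (g w) 0; rewrite ?normr0.
have ign : P.-integrable setT (EFin \o gn).
  apply: le_integrable ig => //.
    by apply/measurable_EFinP; exact: (measurableT_comp mmaxN).
  move=> w _; rewrite /= lee_fin /gn.
  by have [g0|g0] := leP (- g w) 0; rewrite ?normr0// normrN.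
have fgp := integrable_fin_num measurableT igp.
have fgn := integrable_fin_num measurableT ign.
have hp : free_mean (predU1 k K) (fun w => U w * gp w) (u * fine (\int[P]_w (gp w)%:E)).
  apply: free_mean_mul_ge0 (esym (fineK fgp)) => //.
    exact: (adapted_comp mmax).
  by move=> w; rewrite /gp le_max lexx orbT.
have hn : free_mean (predU1 k K) (fun w => U w * gn w) (u * fine (\int[P]_w (gn w)%:E)).
  apply: free_mean_mul_ge0 (esym (fineK fgn)) => //.
    exact: (adapted_comp mmaxN).
  by move=> w; rewrite /gn le_max lexx orbT.
have -> : e = fine (\int[P]_w (gp w)%:E) - fine (\int[P]_w (gn w)%:E).
  have <- : fine (\int[P]_w (g w)%:E) = e by rewrite gE.
  under eq_integral do rewrite gpn EFinB.
  by rewrite integralB// fineB.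
have := free_mean_lin 1 (-1) hp hn.
by apply: eq_free_mean => [w|]; rewrite mul1r mulN1r -mulrBr -?gpn.
Qed.

End independent_products.

(** Products are measurable on the type equipped with the sigma-algebra generated by [F], which is
    [F] itself. *)
Lemma adaptedM d (T : measurableType d) (R : realType) (F : set (set T))
    (f g : T -> R) : sigma_algebra setT F ->
  adapted F f -> adapted F g -> adapted F (fun w => f w * g w).
Proof.
move=> sF fF gF B mB; rewrite -(sigma_algebra_id sF).
have m_of (u : T -> R) : adapted F u ->
    measurable_fun [set: g_sigma_algebraType F] (u : g_sigma_algebraType F -> R).
  by move=> uF _ C mC; rewrite setTI; apply: sub_sigma_algebra; exact: uF.
have := measurable_funM (m_of _ fF) (m_of _ gF) measurableT mB.
by rewrite setTI.
Qed.

(** * Square-integrable random variables *)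

Section square_integrable.
Context d (T : measurableType d) (R : realType) (P : probability T R).

(** The product is dominated by [X ^+ 2 + Y ^+ 2]. *)
Lemma integrable_mul_sqr (X Y : T -> R) :
  measurable_fun [set: T] X -> measurable_fun [set: T] Y ->
  P.-integrable setT (fun w => (X w * X w)%:E) ->
  P.-integrable setT (fun w => (Y w * Y w)%:E) ->
  P.-integrable setT (fun w => (X w * Y w)%:E).
Proof.
move=> mX mY iX iY; apply: le_integrable (integrableD measurableT iX iY) => //.
  exact/measurable_EFinP/measurable_funM.
move=> w _; rewrite /= lee_fin ler_norml ger0_norm.
  by apply/andP; split; nra.
by rewrite addr_ge0// -expr2 sqr_ge0.
Qed.

(** For a centered variable the variance is the second moment; its finiteness yields integrability
    of [X], on pairing [X] with the constant 1. *)
Lemma centered_variance (X : {RV P >-> R}) v :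
  ('E_P[X] = 0 -> 'V_P[X] = v%:E ->
  [/\ P.-integrable setT (EFin \o X), \int[P]_w (X w)%:E = 0%:E,
      P.-integrable setT (fun w => (X w * X w)%:E) &
      \int[P]_w (X w * X w)%:E = v%:E])%E.
Proof.
move=> EX VX; have mX : measurable_fun [set: T] X by [].
have VE : (\int[P]_w (X w * X w)%:E = v%:E)%E.
  rewrite -VX /variance covariance.unlock EX expectation.unlock.
  apply: eq_integral => w _ /=; congr _%:E.
  by rewrite -[in LHS](subr0 (X w)).
have iXX : P.-integrable setT (fun w => (X w * X w)%:E).
  apply/integrableP; split; first exact/measurable_EFinP/measurable_funM.
  under eq_integral do rewrite /= ger0_norm -?expr2 ?sqr_ge0//.
  by rewrite VE ltry.
split=> //; last by move: EX; rewrite expectation.unlock.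
have := @integrable_mul_sqr X (cst 1) mX _ iXX.
have -> : (fun w => (X w * cst 1 w)%:E) = EFin \o X.
  by apply/funext => w; rewrite mulr1.
apply=> //.
have -> : (fun w => (cst 1 w * cst 1 w)%:E) = EFin \o cst 1 :> (T -> \bar R).
  by apply/funext => w; rewrite /= mulr1.
exact: finite_measure_integrable_cst.
Qed.

End square_integrable.

(** * Linear recurrences with a vanishing perturbation *)

Section recurrences.
Context (R : realType).

Lemma cvg_contraction (k : R) (u e : nat -> R) : 0 <= k -> k < 1 ->
  (forall t, 0 <= u t) -> (forall t, u t.+1 <= k * u t + e t) ->
  e t @[t --> \oo] --> 0 -> u t @[t --> \oo] --> 0.
Proof.
move=> k0 k1 u0 ue /cvgrPdist_lt e0.
apply/cvgrPdist_lt => eps eps0.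
(* With this bound on [e], the value [eps / 2] is the fixed point of the majorizing map sending [v]
   to [k * v + (1 - k) * (eps / 2)]. *)
have [|N _ eN] := e0 ((1 - k) * (eps / 2)).
  by rewrite mulr_gt0 ?subr_gt0// divr_gt0.
have uN j : u (N + j)%N <= k ^+ j * u N + eps / 2.
  elim: j => [|j IH]; first by rewrite addn0 expr0 mul1r lerDl; lra.
  rewrite addnS; apply: le_trans (ue _) _.
  have := eN (N + j)%N (leq_addr _ _); rewrite sub0r normrN ltr_norml => /andP[_ ej].
  have := ler_wpM2l k0 IH; rewrite exprS; lra.
have : k ^+ j * u N @[j --> \oo] --> 0 * u N.
  by apply: cvgMl; apply: cvg_expr; rewrite ger0_norm.
rewrite mul0r => /cvgrPdist_lt /(_ (eps / 2)) [|M _ kM]; first lra.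
exists (N + M)%N => // t /= NMt.
have := kM (t - N)%N; rewrite /= leq_subRL ?(leq_trans (leq_addr _ _) NMt)// => /(_ NMt).
have := uN (t - N)%N; rewrite subnKC ?(leq_trans (leq_addr _ _) NMt)//.
rewrite !sub0r !normrN (ger0_norm (u0 t)) ger0_norm; last first.
  by rewrite mulr_ge0 ?exprn_ge0.
lra.
Qed.

(* The row vector (1 - n22 + n21, 1 - n11 + n12) is (1, 1) adj(1 - N): it is
   positive, and the weighted l1-norm it defines is contracted by N. *)
Lemma cvg_affine2 (n11 n12 n21 n22 k : R) (A D e : nat -> R) :
  let det := (1 - n11) * (1 - n22) - n12 * n21 in
  0 <= n11 -> 0 <= n12 -> 0 <= n21 -> 0 <= n22 -> n11 < 1 -> 0 < det ->
  (forall t, A t.+1 = n11 * A t + n12 * D t + k + e t) ->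
  (forall t, D t.+1 = n21 * A t + n22 * D t + k + e t) ->
  e t @[t --> \oo] --> 0 ->
  A t @[t --> \oo] --> (1 - n22 + n12) * k / det.
Proof.
move=> det n11_ge0 n12_ge0 n21_ge0 n22_ge0 n11_lt1 det_gt0 AS DS e0.
have n22_lt1 : n22 < 1.
  rewrite -subr_gt0 -(pmulr_rgt0 _ (_ : 0 < 1 - n11)) ?subr_gt0//.
  by apply: lt_le_trans det_gt0 _; rewrite /det lerBlDr lerDl mulr_ge0.
(* The fixed point of the unperturbed system, by Cramer's rule. *)
pose a := (1 - n22 + n12) * k / det; pose f := (1 - n11 + n21) * k / det.
have det_neq0 : det != 0 by rewrite gt_eqF.
have aE : a = n11 * a + n12 * f + k by rewrite /a /f /det; field.
have fE : f = n21 * a + n22 * f + k by rewrite /a /f /det; field.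
pose al := 1 - n22 + n21; pose be := 1 - n11 + n12.
have al_gt0 : 0 < al by rewrite /al; lra.
have be_gt0 : 0 < be by rewrite /be; lra.
have s_gt0 : 0 < al + be by exact: addr_gt0.
pose L t := al * `|A t - a| + be * `|D t - f|.
(* The row [(al, be)] times N is [(al - det, be - det)]. This [r] makes both entries at most
   [r * al] and [r * be], because [al] and [be] are below [al + be]. *)
pose r := 1 - det / (al + be).
have r1 : r < 1 by rewrite /r ltrBlDr ltrDl divr_gt0.
have al_det : (1 - r) * al <= det.
  rewrite /r opprB addrCA subrr addr0 mulrAC ler_pdivrMr//.
  by rewrite ler_pM2l// lerDl ltW.
have be_det : (1 - r) * be <= det.
  rewrite /r opprB addrCA subrr addr0 mulrAC ler_pdivrMr//.
  by rewrite ler_pM2l// lerDr ltW.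
have alE : al * n11 + be * n21 = al - det by rewrite /al /be /det; ring.
have beE : al * n12 + be * n22 = be - det by rewrite /al /be /det; ring.
have r0 : 0 <= r.
  rewrite subr_ge0 ler_pdivrMr//.
  have : 0 <= al * n11 + be * n21 by rewrite addr_ge0// mulr_ge0// ltW.
  by rewrite alE; lra.
have tri x y (z u v : R) : 0 <= x -> 0 <= y ->
    `|x * u + y * v + z| <= x * `|u| + y * `|v| + `|z|.
  move=> x0 y0; apply: le_trans (ler_normD _ _) _; rewrite lerD2r.
  by apply: le_trans (ler_normD _ _) _; rewrite !normrM (ger0_norm x0) (ger0_norm y0).
have L0 : L t @[t --> \oo] --> 0.
  apply: (@cvg_contraction r _ (fun t => (al + be) * `|e t|)) => //.
  - by move=> t; rewrite addr_ge0// mulr_ge0// ltW.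
  - move=> t; rewrite /L AS DS.
    have -> : n11 * A t + n12 * D t + k + e t - a =
        n11 * (A t - a) + n12 * (D t - f) + e t by rewrite {1}aE; ring.
    have -> : n21 * A t + n22 * D t + k + e t - f =
        n21 * (A t - a) + n22 * (D t - f) + e t by rewrite {1}fE; ring.
    have := ler_wpM2l (ltW al_gt0) (tri n11 n12 (e t) (A t - a) (D t - f) n11_ge0 n12_ge0).
    have := ler_wpM2l (ltW be_gt0) (tri n21 n22 (e t) (A t - a) (D t - f) n21_ge0 n22_ge0).
    have := ler_wpM2r (normr_ge0 (A t - a)) al_det.
    have := ler_wpM2r (normr_ge0 (D t - f)) be_det.
    have := congr1 ( *%R^~ `|A t - a|) alE; have := congr1 ( *%R^~ `|D t - f|) beE.
    move: `|A t - a| `|D t - f| `|e t| => x y z /=.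
    by lra.
  - rewrite -(mulr0 (al + be)); apply: cvgMr.
    by rewrite -(@normr0 _ R); apply: cvg_norm.
rewrite -[X in _ --> X]add0r -/a.
rewrite (_ : A = (fun t => (A t - a) + a)); last by apply/funext => t; rewrite subrK.
apply: cvgD; last exact: cvg_cst.
apply/norm_cvg0P.
apply: (squeeze_cvgr _ (cvg_cst 0) (_ : al^-1 * L t @[t --> \oo] --> 0)).
  near=> t; rewrite normr_ge0/= ler_pdivlMl// /L lerDl mulr_ge0// ltW//.
by rewrite -(mulr0 al^-1); exact: cvgMr.
Unshelve. all: by end_near. Qed.

End recurrences.

(** * Moments of a gradient step and of a communication step *)

Section moments.
Context (R : realType) (d : measure_display) (T : measurableType d)
  (P : probability T R) (p : nat) (theta : 'I_p -> R)
  (eta zeta c sigma_b sigma_h : R)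
  (x0 : 'I_p -> {RV P >-> R}) (comm : nat -> {RV P >-> bool})
  (b h : nat -> 'I_p -> {RV P >-> R}).

Local Notation G := (source_sigma (fun i => x0 i) (fun t => comm t)
  (fun t i => b t i) (fun t i => h t i)).
Local Notation X := (wasgd theta eta c (fun i => x0 i) (fun t => comm t)
  (fun t i => b t i) (fun t i => h t i)).

Hypotheses (x0_L2 : forall i, (x0 i : T -> R) \in Lfun P 2%:E)
  (comm_prob : forall t, P [set w | comm t w = true] = zeta%:E)
  (b_mean : forall t i, ('E_P[b t i] = 0)%E)
  (b_var : forall t i, 'V_P[b t i] = (sigma_b ^+ 2)%:E)
  (h_mean : forall t i, ('E_P[h t i] = 0)%E)
  (h_var : forall t i, 'V_P[h t i] = (sigma_h ^+ 2)%:E)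
  (indep : mutually_independent P G).

Lemma preimage_system_measurable d' (U : measurableType d')
    (f : {RV P >-> U}) : preimage_set_system setT f measurable `<=` measurable.
Proof. by move=> _ [B mB <-]; exact: measurable_funPT. Qed.

Lemma source_measurable k : G k `<=` measurable.
Proof.
case: k => [[t|[t i]]|] /=; first exact: preimage_system_measurable.
- apply: smallest_sub; first exact: sigma_algebra_measurable.
  by rewrite subUset; split; exact: preimage_system_measurable.
- apply: smallest_sub; first exact: sigma_algebra_measurable.
  elim/big_ind: _ => // [A B mA mB|i _].
    by rewrite subUset.
  exact: preimage_system_measurable.
Qed.

Lemma adapted_x0 i : adapted (G None) (x0 i).
Proof.
move=> B mB; apply: sub_sigma_algebra.
rewrite (bigD1 i)//=; left; exists B => //.
by rewrite setTI.
Qed.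

Lemma adapted_comm t (g : bool -> R) :
  adapted (G (Some (inl t))) (fun w => g (comm t w)).
Proof. by move=> B mB; exists (g @^-1` B) => //; rewrite setTI. Qed.

Lemma adapted_b t i : adapted (G (Some (inr (t, i)))) (b t i).
Proof.
by move=> B mB; apply: sub_sigma_algebra; left; exists B; rewrite ?setTI.
Qed.

Lemma adapted_h t i : adapted (G (Some (inr (t, i)))) (h t i).
Proof.
by move=> B mB; apply: sub_sigma_algebra; right; exists B; rewrite ?setTI.
Qed.

(** The covariance of the two centered noises of one gradient sample, which may vary with the step
    and the worker. *)
Let rho t i := fine (\int[P]_w (b t i w * h t i w)%:E).

(** The bound is uniform in [t], so that [rho t i] times a vanishing mean still vanishes. *)
Lemma rho_le t i : `|rho t i| <= sigma_b ^+ 2 + sigma_h ^+ 2.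
Proof.
have [_ _ ibb Ebb] := centered_variance (b_mean t i) (b_var t i).
have [_ _ ihh Ehh] := centered_variance (h_mean t i) (h_var t i).
have ibh : P.-integrable setT (fun w => (b t i w * h t i w)%:E).
  exact: integrable_mul_sqr.
rewrite -lee_fin /rho -abse_EFin fineK; last exact: integrable_fin_num ibh.
apply: le_trans (le_abse_integral P measurableT (measurable_int _ ibh)) _.
rewrite EFinD -Ebb -Ehh -integralD//; apply: ge0_le_integral => //.
- by apply: measurableT_comp => //; exact: measurable_int ibh.
- exact: measurable_int (integrableD measurableT ibb ihh).
move=> w _; rewrite /= lee_fin ler_norml.
by apply/andP; split; nra.
Qed.

Local Notation FM := (free_mean P G).
Local Notation noise t i := (Some (inr (t, i))).

Lemma free_mean_cst1 K : FM K (cst 1) 1.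
Proof. exact: free_mean_sub (free_mean1 source_measurable indep). Qed.

(** The pair of noises is a single source and can be consumed only once, so each monomial in [b] and
    [h] of degree at most two that occurs is multiplied in as one function. *)
Lemma free_mean_noise K t i U u : FM K U u -> ~~ K (noise t i) ->
  [/\ FM (predU1 (noise t i) K) (fun w => U w * b t i w) 0,
      FM (predU1 (noise t i) K) (fun w => U w * h t i w) 0,
      FM (predU1 (noise t i) K) (fun w => U w * (b t i w * b t i w)) (u * sigma_b ^+ 2),
      FM (predU1 (noise t i) K) (fun w => U w * (b t i w * h t i w)) (u * rho t i) &
      FM (predU1 (noise t i) K) (fun w => U w * (h t i w * h t i w)) (u * sigma_h ^+ 2)].
Proof.
move=> KU Kn.
have [ib Eb ibb Ebb] := centered_variance (b_mean t i) (b_var t i).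
have [ih Eh ihh Ehh] := centered_variance (h_mean t i) (h_var t i).
have ibh : P.-integrable setT (fun w => (b t i w * h t i w)%:E).
  exact: integrable_mul_sqr.
have sG : sigma_algebra setT (G (noise t i)) by exact: smallest_sigma_algebra.
have ab := @adapted_b t i; have ah := @adapted_h t i.
have mul := free_mean_mul source_measurable KU Kn.
split.
- by rewrite -(mulr0 u); exact: mul.
- by rewrite -(mulr0 u); exact: mul.
- by apply: mul => //; exact: adaptedM.
- apply: mul => //; first exact: adaptedM.
  by rewrite /rho fineK//; exact: integrable_fin_num ibh.
- by apply: mul => //; exact: adaptedM.
Qed.

Local Notation upd t i x :=
  (fun w => sgd_update eta c (b t i w) (h t i w) (x w)).

(** The spectator [Y] is 1 for first moments and the iterate of another worker for mixed moments.
    The noise is centered, so only the factor [1 - eta * c] remains. *)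
Lemma free_mean_sgd K t i (Y x : T -> R) y z :
  ~~ K (noise t i) -> FM K Y y -> FM K (fun w => Y w * x w) z ->
  FM (predU1 (noise t i) K) (fun w => Y w * upd t i x w) ((1 - eta * c) * z).
Proof.
move=> Kn KY KYx.
have [KYxb _ _ _ _] := free_mean_noise KYx Kn.
have [_ KYh _ _ _] := free_mean_noise KY Kn.
have KYx' : FM (predU1 (noise t i) K) (fun w => Y w * x w) z.
  by apply: free_mean_sub KYx => k /= ->; rewrite orbT.
have := free_mean_lin (1 - eta * c) 1 KYx' (free_mean_lin eta eta KYxb KYh).
by apply: eq_free_mean => [w|]; rewrite /sgd_update /grad_sample; ring.
Qed.

Lemma free_mean_sgd_sqr K t i (x : T -> R) m q :
  ~~ K (noise t i) -> FM K x m -> FM K (fun w => x w * x w) q ->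
  FM (predU1 (noise t i) K) (fun w => upd t i x w * upd t i x w)
    ((1 - eta * c) ^+ 2 * q +
     eta ^+ 2 * (sigma_b ^+ 2 * q + 2 * rho t i * m + sigma_h ^+ 2)).
Proof.
move=> Kn Kx Kxx.
have [Kxxb _ Kxxbb _ _] := free_mean_noise Kxx Kn.
have [_ Kxh _ Kxbh _] := free_mean_noise Kx Kn.
have [_ _ _ _ K1hh] := free_mean_noise (@free_mean_cst1 K) Kn.
have Kxx' : FM (predU1 (noise t i) K) (fun w => x w * x w) q.
  by apply: free_mean_sub Kxx => k /= ->; rewrite orbT.
set r := 1 - eta * c.
(* Expansion of the square of [r * x + eta * (b * x + h)]; the first group is linear in the noise
   and has mean 0. *)
have := free_meanD (free_mean_lin (2 * r * eta) (2 * r * eta) Kxxb Kxh)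
  (free_meanD (free_mean_lin (r ^+ 2) (eta ^+ 2) Kxx' Kxxbb)
    (free_mean_lin (2 * eta ^+ 2) (eta ^+ 2) Kxbh K1hh)).
by apply: eq_free_mean => [w|]; rewrite /sgd_update /grad_sample /r /=; ring.
Qed.

(** The sources of the iterates at time [t]. The inequality is strict because the sources indexed by
    [s] produce the iterates at time [s.+1]. *)
Definition past t : pred (option (nat + nat * 'I_p)) := fun k =>
  match k with
  | None => true
  | Some (inl s) => (s < t)%N
  | Some (inr (s, _)) => (s < t)%N
  end.

(* The sources a gradient step at time t depends on, whatever the flag. *)
Definition past_noise t : pred (option (nat + nat * 'I_p)) := fun k =>
  match k with
  | None => true
  | Some (inl s) => (s < t)%N
  | Some (inr (s, _)) => (s <= t)%N
  end.

(** With [C] the indicator of the flag, the conditional is [U * C + (V - V * C)], and the flag of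
    step [t] is a source of neither [U] nor [V]. *)
Lemma free_mean_comm t U V u v : FM (past t) U u -> FM (past_noise t) V v ->
  FM (past t.+1) (fun w => if comm t w then U w else V w)
    (zeta * u + (1 - zeta) * v).
Proof.
move=> tU tV.
have flag K W x : FM K W x -> ~~ K (Some (inl t)) -> subpred K (past t.+1) ->
    FM (past t.+1) W x /\
    FM (past t.+1) (fun w => W w * (comm t w)%:R) (x * zeta).
  move=> KW Kt Kt1; split; first exact: free_mean_sub KW.
  apply: (@free_mean_sub _ _ _ _ _ _ (predU1 (Some (inl t)) K)).
    by move=> k /predU1P[-> /=|/Kt1].
  pose C w : R := (comm t w)%:R.
  have E : C = \1_[set w | comm t w = true].
    by apply/funext => w; rewrite indicE; congr (nat_of_bool _)%:R; apply/idP/idP; rewrite inE.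
  have mC : measurable [set w | comm t w = true].
    apply: (@preimage_system_measurable _ _ (comm t)).
    by exists [set true] => //; rewrite setTI.
  apply: (@free_mean_mul _ _ _ _ _ _ source_measurable _ _ _ _ C _ KW Kt).
  - exact: (@adapted_comm t (fun a => a%:R)).
  - by rewrite E; exact: (integrable_indic P mC).
  - by rewrite E integral_indic// setIT; exact: comm_prob.
have [] := flag _ _ _ tU; [by rewrite /= ltnn|by case=> [[s|[s i]]|]//=; exact: ltnW|].
move=> _ tUc.
have [] := flag _ _ _ tV; [by rewrite /= ltnn|by case=> [[s|[s i]]|]//=; exact: ltnW|].
move=> tV1 tVc.
have := free_mean_lin 1 1 tUc (free_mean_lin 1 (-1) tV1 tVc).
apply: eq_free_mean => [w|]; last by ring.
by case: (comm t w) => /=; ring.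
Qed.


(** * Closed recursions for the first and second moments *)

Fixpoint mean1 t i : R :=
  if t is s.+1 then
    zeta * (\sum_j theta j * mean1 s j) + (1 - zeta) * ((1 - eta * c) * mean1 s i)
  else fine (\int[P]_w (x0 i w)%:E).

(** Noises of distinct workers are independent and centered, so the noise contributes only on the
    diagonal, which the multiple [*+ (i == j)] encodes. *)
Fixpoint mean2 t i j : R :=
  if t is s.+1 then
    zeta * (\sum_k \sum_l theta k * theta l * mean2 s k l) +
    (1 - zeta) * ((1 - eta * c) ^+ 2 * mean2 s i j +
      (eta ^+ 2 * (sigma_b ^+ 2 * mean2 s i i + 2 * rho s i * mean1 s i +
        sigma_h ^+ 2)) *+ (i == j))
  else fine (\int[P]_w (x0 i w * x0 j w)%:E).

Lemma wasgdS t i : X t.+1 i = (fun w => if comm t w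
  then weighted_avg theta (fun j => X t j w) else upd t i (X t i) w).
Proof. by []. Qed.

Lemma free_mean_avg K (x : 'I_p -> T -> R) m q :
  (forall i, FM K (x i) (m i)) ->
  (forall i j, FM K (fun w => x i w * x j w) (q i j)) ->
  FM K (fun w => weighted_avg theta (x^~ w)) (\sum_j theta j * m j) /\
  FM K (fun w => weighted_avg theta (x^~ w) * weighted_avg theta (x^~ w))
    (\sum_k \sum_l theta k * theta l * q k l).
Proof.
move=> Km Kq; split.
  by apply: (free_mean_sum source_measurable indep) => j; exact: free_meanZ.
have := free_mean_sum source_measurable indep (index_enum _) (fun k =>
  free_mean_sum source_measurable indep (index_enum _) (fun l =>
    free_meanZ (theta k * theta l) (Kq k l))).
apply: eq_free_mean => // w; rewrite /weighted_avg big_distrlr.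
by apply: eq_bigr => k _; apply: eq_bigr => l _; rewrite mulrACA.
Qed.

Lemma free_mean_wasgd t :
  (forall i, FM (past t) (X t i) (mean1 t i)) /\
  (forall i j, FM (past t) (fun w => X t i w * X t j w) (mean2 t i j)).
Proof.
elim: t => [|t [IH1 IH2]].
  (* The whole starting vector is one source, so a product of two starting points is again a
     function of that source. *)
  have Ninit f : adapted (G None) f -> P.-integrable setT (EFin \o f) ->
      FM (past 0) f (fine (\int[P]_w (f w)%:E)).
    move=> aF iF; have fF := integrable_fin_num measurableT iF.
    have f1 := free_mean_mul source_measurable (@free_mean_cst1 pred0) isT aF iF
      (esym (fineK fF)).
    suff : FM (past 0) (fun w => cst 1 w * f w) (1 * fine (\int[P]_w (f w)%:E)).
      by apply: eq_free_mean => [w|]; rewrite mul1r.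
    by apply: free_mean_sub f1 => k /predU1P[->|].
  split=> [i|i j]; apply: Ninit.
  - exact: adapted_x0.
  - apply/Lfun1_integrable/Lfun_subset12; last exact: x0_L2.
    exact: fin_num_measure.
  - by apply: adaptedM; [exact: smallest_sigma_algebra|exact: adapted_x0..].
  - by apply/Lfun1_integrable; exact: (Lfun2_mul_Lfun1 (x0_L2 i) (x0_L2 j)).
have [avg1 avg2] := free_mean_avg IH1 IH2.
have Npast i : ~~ past t (noise t i) by rewrite /= ltnn.
have past_sub i : subpred (predU1 (noise t i) (past t)) (past_noise t).
  move=> k /predU1P[->|]; first by rewrite /= leqnn.
  by case: k => [[s|[s l]]|]//=; exact: ltnW.
have IH1' i : FM (past t) (fun w => cst 1 w * X t i w) (mean1 t i).
  by apply: eq_free_mean (IH1 i) => // w; rewrite mul1r.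
have sgd1 i : FM (predU1 (noise t i) (past t)) (upd t i (X t i))
    ((1 - eta * c) * mean1 t i).
  apply: eq_free_mean (free_mean_sgd (Npast i) (@free_mean_cst1 _) (IH1' i)) => // w.
  by rewrite mul1r.
split=> [i|i j].
  by apply: free_mean_comm => //; exact: free_mean_sub (past_sub i) (sgd1 i).
have -> : (fun w => X t.+1 i w * X t.+1 j w) = (fun w => if comm t w
    then weighted_avg theta (fun j => X t j w) * weighted_avg theta (fun j => X t j w)
    else upd t i (X t i) w * upd t j (X t j) w).
  by apply/funext => w; rewrite !wasgdS; case: (comm t w).
apply: free_mean_comm => //=; have [<-{j}|ij] := eqVneq i j.
  rewrite mulr1n; apply: free_mean_sub (past_sub i) _.
  exact: free_mean_sgd_sqr.
rewrite mulr0n addr0.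
have Nj : ~~ predU1 (noise t i) (past t) (noise t j).
  rewrite /= ltnn orbF; apply/eqP => -[ji]; by rewrite ji eqxx in ij.
(* For distinct workers the gradient step is applied twice: to worker [i] with the old iterate of
   [j] as spectator, then to [j] with the updated iterate of [i] as spectator. *)
have ji : FM (predU1 (noise t i) (past t)) (fun w => upd t i (X t i) w * X t j w)
    ((1 - eta * c) * mean2 t i j).
  have tji : FM (past t) (fun w => X t j w * X t i w) (mean2 t i j).
    by apply: eq_free_mean (IH2 i j) => // w; rewrite mulrC.
  by apply: eq_free_mean (free_mean_sgd (Npast i) (IH1 j) tji) => // w; rewrite mulrC.
have := free_mean_sgd Nj (sgd1 i) ji.
rewrite mulrA -expr2; apply: free_mean_sub => k /predU1P[->|/past_sub//].
by rewrite /= leqnn.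
Qed.

Definition avg_mean1 t := \sum_j theta j * mean1 t j.
Definition avg_mean2 t := \sum_k \sum_l theta k * theta l * mean2 t k l.
Definition diag_mean2 t := \sum_i theta i ^+ 2 * mean2 t i i.

Lemma variance_avg t :
  'V_P[fun w => weighted_avg theta (fun i => X t i w)] =
  (avg_mean2 t - avg_mean1 t ^+ 2)%:E.
Proof.
have [tX tXX] := free_mean_wasgd t; have [tY tYY] := free_mean_avg tX tXX.
rewrite -/(avg_mean1 t) in tY; rewrite -/(avg_mean2 t) in tYY.
have [_ EY] := free_mean_integral tY.
rewrite /variance covariance.unlock expectation.unlock EY.
set Y := fun w => weighted_avg theta (X t ^~ w).
have tVar := free_mean_lin 1 1 tYY (free_mean_lin (- (2 * avg_mean1 t))
  (avg_mean1 t ^+ 2) tY (@free_mean_cst1 (past t))).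
rewrite [RHS](_ : _ = (1 * avg_mean2 t +
  1 * (- (2 * avg_mean1 t) * avg_mean1 t + avg_mean1 t ^+ 2 * 1))%:E); last first.
  by congr _%:E; ring.
have [_ <-] := free_mean_integral tVar.
apply: eq_integral => w _; congr _%:E.
rewrite -[LHS]/((Y w - avg_mean1 t) * (Y w - avg_mean1 t)) /=; rewrite /Y; ring.
Qed.

(** * The two-dimensional recursion and the limit of the variance *)

Section asymptotics.
Variables omega delta : R.
Hypotheses (theta_sum : \sum_(i < p) theta i = 1)
  (eta_gt0 : 0 < eta) (zeta_ge0 : 0 <= zeta) (zeta_lt1 : zeta < 1)
  (omegaE : omega = \sum_(i < p) theta i ^+ 2)
  (deltaE : delta = zeta / ((1 - zeta) * eta * (2 * c - eta * c ^+ 2)))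
  (stable_mean : 0 < 2 * c - eta * c ^+ 2)
  (stable_var : 0 < 2 * c - eta * c ^+ 2
       - eta * sigma_b ^+ 2 * ((1 + delta * omega) / (1 + delta))).

Let r := 1 - eta * c.
Let s := 2 * c - eta * c ^+ 2.
Let err t := 2 * (1 - zeta) * eta ^+ 2 *
  \sum_i theta i ^+ 2 * (rho t i * mean1 t i).
Let n11 := zeta + (1 - zeta) * r ^+ 2.
Let n12 := (1 - zeta) * (eta ^+ 2 * sigma_b ^+ 2).
Let n21 := zeta * omega.
Let n22 := (1 - zeta) * (r ^+ 2 + eta ^+ 2 * sigma_b ^+ 2).
Let k := (1 - zeta) * (eta ^+ 2 * (sigma_h ^+ 2 * omega)).

(** Communication preserves the weighted mean because the weights sum to 1. *)
Lemma avg_mean1S t : avg_mean1 t.+1 = (zeta + (1 - zeta) * r) * avg_mean1 t.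
Proof.
rewrite /avg_mean1 /= -/(avg_mean1 t).
under eq_bigr do rewrite mulrDr.
rewrite big_split/= -mulr_suml theta_sum mul1r mulrDl; congr (_ + _).
rewrite [in RHS]/avg_mean1 mulr_sumr; apply: eq_bigr => i _; rewrite /r; ring.
Qed.

(** The same noise input drives both recursions: in the quadratic form of the average only diagonal
    entries receive noise, with weight [theta i ^+ 2]. *)
Let noise_sum t :
  \sum_i theta i ^+ 2 * ((1 - zeta) * (eta ^+ 2 * (sigma_b ^+ 2 * mean2 t i i +
    2 * rho t i * mean1 t i + sigma_h ^+ 2))) =
  n12 * diag_mean2 t + k + err t.
Proof.
rewrite /diag_mean2 /k /err omegaE !mulr_sumr -!big_split/=.
by apply: eq_bigr => i _; rewrite /n12; ring.
Qed.

(** Communication replaces every diagonal entry by [avg_mean2 t], whence the coefficient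
    [zeta * omega]. *)
Lemma diag_mean2S t :
  diag_mean2 t.+1 = n21 * avg_mean2 t + n22 * diag_mean2 t + k + err t.
Proof.
rewrite {1}/diag_mean2 /= -/(avg_mean2 t).
under eq_bigr do rewrite eqxx mulr1n mulrDr mulrDr mulrDr.
rewrite !big_split/= noise_sum -mulr_suml -omegaE.
have -> : \sum_i theta i ^+ 2 * ((1 - zeta) * ((1 - eta * c) ^+ 2 * mean2 t i i)) =
    (1 - zeta) * r ^+ 2 * diag_mean2 t.
  by rewrite mulr_sumr; apply: eq_bigr => i _; rewrite /r; ring.
by rewrite /n21 /n22 /n12; ring.
Qed.

Lemma avg_mean2S t :
  avg_mean2 t.+1 = n11 * avg_mean2 t + n12 * diag_mean2 t + k + err t.
Proof.
rewrite {1}/avg_mean2 /= -/(avg_mean2 t).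
under eq_bigr do under eq_bigr do rewrite mulrDr mulrDr mulrDr.
under eq_bigr do rewrite !big_split/=.
rewrite !big_split/=.
have -> : \sum_i \sum_j theta i * theta j * (zeta * avg_mean2 t) = zeta * avg_mean2 t.
  under eq_bigr do rewrite -mulr_suml -mulr_sumr theta_sum mulr1.
  by rewrite -mulr_suml theta_sum mul1r.
have -> : \sum_i \sum_j theta i * theta j *
    ((1 - zeta) * ((1 - eta * c) ^+ 2 * mean2 t i j)) =
    (1 - zeta) * r ^+ 2 * avg_mean2 t.
  rewrite mulr_sumr; apply: eq_bigr => i _; rewrite mulr_sumr.
  by apply: eq_bigr => j _; rewrite /r; ring.
under eq_bigr => i _.
  rewrite (bigD1 i)//= eqxx mulr1n big1 ?addr0 -?expr2; last first.
    by move=> j; rewrite eq_sym => /negbTE ->; rewrite mulr0n !mulr0.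
  over.
by rewrite noise_sum /n11; ring.
Qed.

Let sqr_r : r ^+ 2 = 1 - eta * s. Proof. by rewrite /r /s; ring. Qed.

(** By [stable_mean], [r ^+ 2 = 1 - eta * s] is less than 1. *)
Let r_lt1 : `|r| < 1.
Proof.
rewrite ltr_norml; have : 0 < eta * s by exact: mulr_gt0.
by move: sqr_r => rE es; apply/andP; split; nra.
Qed.

Lemma avg_mean1_cvg0 : avg_mean1 t @[t --> \oo] --> 0.
Proof.
apply/norm_cvg0P.
apply: (@cvg_contraction _ (zeta + (1 - zeta) * `|r|) _ (fun=> 0)).
- by rewrite addr_ge0// mulr_ge0// subr_ge0 ltW.
- rewrite -subr_gt0 (_ : _ - _ = (1 - zeta) * (1 - `|r|)); last by ring.
  by rewrite mulr_gt0// subr_gt0.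
- by move=> t.
- move=> t; rewrite avg_mean1S normrM addr0 ler_wpM2r//.
  apply: le_trans (ler_normD _ _) _.
  by rewrite normrM (ger0_norm zeta_ge0) ger0_norm// subr_ge0 ltW.
- exact: cvg_cst.
Qed.

(** Each mean contracts by at most [(1 - zeta) * |r|] per step; the weighted mean, already known to
    vanish, enters as the perturbation. *)
Lemma mean1_cvg0 i : mean1 t i @[t --> \oo] --> 0.
Proof.
apply/norm_cvg0P.
apply: (@cvg_contraction _ ((1 - zeta) * `|r|) _ (fun t => zeta * `|avg_mean1 t|)).
- by rewrite mulr_ge0// subr_ge0 ltW.
- by apply: le_lt_trans r_lt1; rewrite -[leRHS]mul1r ler_wpM2r// gerBl.
- by move=> t.
- move=> t; rewrite addrC -[mean1 _ _]/(zeta * avg_mean1 t + (1 - zeta) * (r * mean1 t i)).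
  apply: le_trans (ler_normD _ _) _.
  by rewrite !normrM (ger0_norm zeta_ge0) (@ger0_norm _ (1 - zeta)) ?mulrA// subr_ge0 ltW.
- rewrite -(mulr0 zeta); apply: cvgMr; apply/norm_cvg0P.
  exact: avg_mean1_cvg0.
Qed.

Lemma err_cvg0 : err t @[t --> \oo] --> 0.
Proof.
rewrite -[X in _ --> X](mulr0 (2 * (1 - zeta) * eta ^+ 2)); apply: cvgMr.
pose F i t := theta i ^+ 2 * (rho t i * mean1 t i).
suff F0 i : F i t @[t --> \oo] --> 0.
  elim: (index_enum _) => [|i q IH].
    have -> : (fun t => \sum_(i <- [::]) F i t) = (fun=> 0).
      by apply/funext => t; rewrite big_nil.
    exact: cvg_cst.
  have -> : (fun t => \sum_(j <- i :: q) F j t) =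
      (fun t => F i t + \sum_(j <- q) F j t).
    by apply/funext => t; rewrite big_cons.
  by rewrite -[X in _ --> X](addr0 0); exact: cvgD.
rewrite -(mulr0 (theta i ^+ 2)); apply: cvgMr; apply/norm_cvg0P.
apply: (squeeze_cvgr _ (cvg_cst 0)
  (_ : (sigma_b ^+ 2 + sigma_h ^+ 2) * `|mean1 t i| @[t --> \oo] --> 0)).
  by near=> t; rewrite normr_ge0/= normrM ler_wpM2r// rho_le.
rewrite -(mulr0 (sigma_b ^+ 2 + sigma_h ^+ 2)); apply: cvgMr; apply/norm_cvg0P.
exact: mean1_cvg0.
Unshelve. all: by end_near. Qed.

Lemma wasgd_variance_cvg :
  'V_P[fun w => weighted_avg theta (fun i => X t i w)] @[t --> \oo] -->
  (eta * sigma_h ^+ 2 * omega *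
     (2 * c - eta * c ^+ 2
      - eta * sigma_b ^+ 2 * ((1 + delta * omega) / (1 + delta)))^-1)%:E.
Proof.
have zeta1 : 0 < 1 - zeta by rewrite subr_gt0.
have omega0 : 0 <= omega by rewrite omegaE sumr_ge0// => i _; exact: sqr_ge0.
have s0 : 0 < s by exact: stable_mean.
have es0 : 0 < eta * s by exact: mulr_gt0.
have delta0 : 0 <= delta by rewrite deltaE divr_ge0// !mulr_ge0// ltW.
(* Solving the definition of [delta] for an isolated [zeta] gives every entry of [1 - N] the factor
   [1 - zeta]; hence only selected occurrences are rewritten below. *)
have zetaE : zeta = delta * ((1 - zeta) * eta * s).
  by rewrite deltaE divfK// gt_eqF// !mulr_gt0.
have delta1 : 0 < 1 + delta by lra.
set V := 2 * c - _ - _; have V0 : 0 < V by exact: stable_var.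
have VE : V * (1 + delta) = s * (1 + delta) - eta * sigma_b ^+ 2 * (1 + delta * omega).
  by rewrite /V /s; field; rewrite gt_eqF.
pose det := (1 - n11) * (1 - n22) - n12 * n21.
have n21E : n21 = delta * ((1 - zeta) * eta * s) * omega.
  by rewrite /n21 {1}zetaE.
have n11E : 1 - n11 = (1 - zeta) * (eta * s) by rewrite /n11 sqr_r; ring.
have n22E : 1 - n22 =
    (1 - zeta) * (eta * (s * (1 + delta) - eta * sigma_b ^+ 2)).
  have -> : 1 - n22 = zeta + (1 - zeta) * (eta * s - eta ^+ 2 * sigma_b ^+ 2).
    by rewrite /n22 sqr_r; ring.
  by rewrite {1}zetaE; ring.
(* The determinant is a positive multiple of [V], so [stable_var] is what makes it positive. *)
have detE : det = (1 - zeta) ^+ 2 * eta ^+ 2 * s * (1 + delta) * V.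
  rewrite -mulrA (mulrC _ V) VE /det n11E n22E n21E /n12; ring.
(* The [sigma_b] terms cancel in [1 - n22 + n12], leaving [(1 - zeta) * eta * s * (1 + delta)], a
   factor of [det]. *)
have limE : (1 - n22 + n12) * k / det = eta * sigma_h ^+ 2 * omega * V^-1.
  rewrite detE n22E /n12 /k; field.
  by rewrite !gt_eqF.
under eq_cvg do rewrite variance_avg.
apply: cvg_EFin; first by near=> t.
rewrite -limE -[X in _ --> X]subr0.
have esb0 : 0 <= eta ^+ 2 * sigma_b ^+ 2 by apply: mulr_ge0; exact: sqr_ge0.
apply: cvgB.
  apply: (cvg_affine2 _ _ _ _ _ _ avg_mean2S diag_mean2S err_cvg0).
  - by rewrite /n11 addr_ge0// mulr_ge0 ?sqr_ge0// ltW.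
  - by rewrite /n12 mulr_ge0// ltW.
  - exact: mulr_ge0.
  - by apply: mulr_ge0; [exact: ltW|rewrite addr_ge0// sqr_ge0].
  - by rewrite /n11 sqr_r; nra.
  - by rewrite -/det detE !mulr_gt0// exprn_gt0.
rewrite -(mulr0 0); under eq_cvg do rewrite expr2.
by apply: cvgM; exact: avg_mean1_cvg0.
Unshelve. all: by end_near. Qed.

End asymptotics.

End moments.

Theorem lemma2 (R : realType) (d : measure_display) (T : measurableType d)
    (P : probability T R) (p : nat) (theta : 'I_p -> R)
    (eta zeta c sigma_b sigma_h omega delta : R)
    (x0 : 'I_p -> {RV P >-> R}) (comm : nat -> {RV P >-> bool})
    (b h : nat -> 'I_p -> {RV P >-> R})
    (theta_sum : \sum_(i < p) theta i = 1)
    (eta_gt0 : 0 < eta) (zeta_ge0 : 0 <= zeta) (zeta_lt1 : zeta < 1)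
    (omegaE : omega = \sum_(i < p) theta i ^+ 2)
    (deltaE : delta = zeta / ((1 - zeta) * eta * (2 * c - eta * c ^+ 2)))
    (x0_L2 : forall i, (x0 i : T -> R) \in Lfun P 2%:E)
    (comm_prob : forall t, P [set w | comm t w = true] = zeta%:E)
    (b_mean : forall t i, ('E_P[b t i] = 0)%E)
    (b_var : forall t i, 'V_P[b t i] = (sigma_b ^+ 2)%:E)
    (h_mean : forall t i, ('E_P[h t i] = 0)%E)
    (h_var : forall t i, 'V_P[h t i] = (sigma_h ^+ 2)%:E)
    (indep : mutually_independent P
       (source_sigma (fun i => x0 i) (fun t => comm t)
          (fun t i => b t i) (fun t i => h t i)))
    (stable_mean : 0 < 2 * c - eta * c ^+ 2)
    (stable_var : 0 < 2 * c - eta * c ^+ 2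
       - eta * sigma_b ^+ 2 * ((1 + delta * omega) / (1 + delta))) :
  'V_P[fun w => weighted_avg theta (fun i =>
         wasgd theta eta c (fun i => x0 i) (fun t => comm t)
           (fun t i => b t i) (fun t i => h t i) t i w)] @[t --> \oo] -->
  (eta * sigma_h ^+ 2 * omega *
     (2 * c - eta * c ^+ 2
      - eta * sigma_b ^+ 2 * ((1 + delta * omega) / (1 + delta)))^-1)%:E.
Proof.
exact: (wasgd_variance_cvg x0_L2 comm_prob b_mean b_var h_mean h_var indep
  theta_sum eta_gt0 zeta_ge0 zeta_lt1 omegaE deltaE stable_mean stable_var).
Qed.
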